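(* Let $k$ be a field, $X$ a well-ordered set, $\Omega=\{\prec,\succ\}$ (two binary operations), and $S=\{(x\succ y)\prec z-x\succ (y\prec z)\mid x,y,z\in (X,\Omega)\}\subset k(X,\Omega)$. The set $$Irr(S)=\{u\in (X,\Omega)\mid u\neq v|_{(a\succ b)\prec c}\text{ for all } a,b,c\in (X,\Omega)\text{ and all }\star\text{-}\Omega\text{-words } v\}$$ is a $k$-basis of the free $L$-algebra $L(X)=k(X,\Omega|S)=k(X,\Omega)/Id(S)$. Moreover, $Irr(S)$ consists of all normal words in $(X,\Omega)$.
   Context: $(X,\Omega)$ is the set of $\Omega$-words: the smallest set of formal expressions containing $X$ and closed under $u,v\mapsto u\prec v$ and $u,v\mapsto u\succ v$. $k(X,\Omega)$ is the $k$-vector space with basis $(X,\Omega)$, the two operations being extended bilinearly (the free algebra on $X$ with two bilinear binary operations); $Id(S)$ is its two-sided ideal (for both operations) generated by $S$. An $L$-algebra over $k$ is a $k$-space with two bilinear operations $\prec,\succ$ satisfying $(x\succ y)\prec z=x\succ(y\prec z)$ for all $x,y,z$; $L(X)$ is the free $L$-algebra generated by $X$. A $\star$-$\Omega$-word is an element of $(X\cup\{\star\},\Omega)$ ($\star\notin X$) in which $\star$ occurs exactly once; $v|_s$ denotes substitution of $s$ for $\star$ in $v$. Normal words are defined recursively: an $\Omega$-word $u$ is normal if either (i) $u=x\in X$; or (ii) $u=v\succ w$ with $v,w$ normal; or (iii) $u=v\prec w$ with $v,w$ normal and $v$ not of the form $v_1\succ v_2$. *)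

(* Defs.v *)
From HB Require Import structures.
From mathcomp Require Import all_boot all_order all_algebra.
From mathcomp Require Import finmap monalg.
From mathcomp Require Import boolp classical_sets.

Set Implicit Arguments.
Unset Strict Implicit.
Unset Printing Implicit Defensive.

Import Order.TTheory GRing.Theory.

Local Open Scope classical_set_scope.
Local Open Scope ring_scope.
Local Open Scope quotient_scope.

Reserved Notation "x '\prec' y" (at level 40, no associativity).
Reserved Notation "x '\succ' y" (at level 40, no associativity).

Declare Scope word_scope.
Delimit Scope word_scope with W.

Inductive word (X : Type) : Type :=
| Var of X
| Prec of word X & word X
| Succ of word X & word X.

Bind Scope word_scope with word.

Notation "u \prec v" := (Prec u v) : word_scope.
Notation "u \succ v" := (Succ u v) : word_scope.

Section WordChoice.
Variable X : Type.

Fixpoint word_encode (u : word X) : GenTree.tree X :=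
  match u with
  | Var x => GenTree.Leaf x
  | Prec v w => GenTree.Node 0 [:: word_encode v; word_encode w]
  | Succ v w => GenTree.Node 1 [:: word_encode v; word_encode w]
  end.

Fixpoint word_decode (t : GenTree.tree X) : option (word X) :=
  match t with
  | GenTree.Leaf x => Some (Var x)
  | GenTree.Node n [:: t1; t2] =>
      match word_decode t1, word_decode t2 with
      | Some v, Some w => Some (if n == 0 then Prec v w else Succ v w)
      | _, _ => None
      end
  | _ => None
  end.

Lemma word_encodeK : pcancel word_encode word_decode.
Proof. by elim=> //= v -> w ->. Qed.

End WordChoice.

HB.instance Definition _ (X : eqType) :=
  Equality.copy (word X) (pcan_type (@word_encodeK X)).
HB.instance Definition _ (X : choiceType) :=
  Choice.copy (word X) (pcan_type (@word_encodeK X)).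

Section Words.
Variable X : Type.
Local Open Scope word_scope.

(* The alphabet X together with the extra letter star is [option X], the star
   being [None]. *)
Fixpoint star_count (v : word (option X)) : nat :=
  match v with
  | Var None => 1%N
  | Var (Some _) => 0%N
  | v1 \prec v2 => (star_count v1 + star_count v2)%N
  | v1 \succ v2 => (star_count v1 + star_count v2)%N
  end.

Definition star_word (v : word (option X)) : Prop := star_count v = 1%N.

Fixpoint subst_star (v : word (option X)) (s : word X) : word X :=
  match v with
  | Var None => s
  | Var (Some x) => Var x
  | v1 \prec v2 => subst_star v1 s \prec subst_star v2 s
  | v1 \succ v2 => subst_star v1 s \succ subst_star v2 s
  end.

Definition Irr : set (word X) :=
  [set u | forall (a b c : word X) (v : word (option X)), star_word v ->
     u <> subst_star v ((a \succ b) \prec c)].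

Inductive normal_word : word X -> Prop :=
| normal_var x : normal_word (Var x)
| normal_succ v w : normal_word v -> normal_word w -> normal_word (v \succ w)
| normal_prec v w : normal_word v -> normal_word w ->
    (forall v1 v2, v <> v1 \succ v2) -> normal_word (v \prec w).

End Words.

Arguments Irr X : clear implicits.

HB.mixin Record Lmodule_isOmegaAlg (k : fieldType) A of GRing.Lmodule k A := {
  aprec : A -> A -> A;
  asucc : A -> A -> A;
  aprec_linearl : forall y, linear (aprec ^~ y);
  aprec_linearr : forall x, linear (aprec x);
  asucc_linearl : forall y, linear (asucc ^~ y);
  asucc_linearr : forall x, linear (asucc x)
}.

#[short(type="omegaAlgType")]
HB.structure Definition OmegaAlg (k : fieldType) :=
  { A of GRing.Lmodule k A & Lmodule_isOmegaAlg k A }.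

Notation "x \prec y" := (aprec x y) : ring_scope.
Notation "x \succ y" := (asucc x y) : ring_scope.

Section OmegaAlgTheory.
Variable k : fieldType.

Definition omega_morphism (A B : omegaAlgType k) (f : A -> B) : Prop :=
  [/\ linear f, {morph f : x y / x \prec y} & {morph f : x y / x \succ y}].

Definition is_Lalgebra (A : omegaAlgType k) : Prop :=
  forall x y z : A, (x \succ y) \prec z = x \succ (y \prec z).

Definition is_free_Lalgebra (X : Type) (L : omegaAlgType k) (i : X -> L) : Prop :=
  is_Lalgebra L /\
  forall A : omegaAlgType k, is_Lalgebra A -> forall f : X -> A,
    exists! phi : L -> A, omega_morphism phi /\ forall x, phi (i x) = f x.

(* The family (e i) indexed by i \in B is a basis of V; in particular e is
   injective on B. *)
Definition is_basis (V : lmodType k) (I : eqType) (B : set I) (e : I -> V) : Prop :=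
  (forall (s : seq I) (c : I -> k), uniq s -> (forall i, i \in s -> B i) ->
     \sum_(i <- s) c i *: e i = 0 -> forall i, i \in s -> c i = 0) /\
  (forall x : V, exists (s : seq I) (c : I -> k),
     (forall i, i \in s -> B i) /\ x = \sum_(i <- s) c i *: e i).

Definition is_ideal (A : omegaAlgType k) (I : set A) : Prop :=
  [/\ I 0, forall (c : k) x y, I x -> I y -> I (c *: x + y),
      forall x y, I x -> I (x \prec y) /\ I (y \prec x)
    & forall x y, I x -> I (x \succ y) /\ I (y \succ x)].

Definition Id (A : omegaAlgType k) (S : set A) : set A := smallest (@is_ideal A) S.

Lemma Id_ideal (A : omegaAlgType k) (S : set A) : is_ideal (Id S).
Proof.
split=> [I [[]] //|c x y Ix Iy I II|x y Ix|x y Ix].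
- by have [[_ h _ _] _] := II; apply: h; [exact: Ix|exact: Iy].
- by split=> I II; have [[_ _ h _] _] := II; have [] := h x y (Ix I II).
- by split=> I II; have [[_ _ _ h] _] := II; have [] := h x y (Ix I II).
Qed.

End OmegaAlgTheory.

Section QuotientAlgebra.
Variables (k : fieldType) (A : omegaAlgType k) (S : set A).

Definition Idb : {pred A} := fun x => `[< Id S x >].

Lemma Idb_zmod_closed : zmod_closed Idb.
Proof.
have [h0 hD _ _] := Id_ideal S; split=> [|x y /asboolP hx /asboolP hy].
  exact/asboolP.
by apply/asboolP; rewrite addrC -scaleN1r; exact: hD.
Qed.

HB.instance Definition _ := GRing.isZmodClosed.Build A Idb Idb_zmod_closed.

Definition quotAlg : Type := Quotient.quot Idb.

HB.instance Definition _ := Choice.on quotAlg.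
HB.instance Definition _ := GRing.Zmodule.on quotAlg.
HB.instance Definition _ := EqQuotient.on quotAlg.

Definition quot_class (x : A) : quotAlg := \pi_(quotAlg) x.

Lemma quot_classP x y : quot_class x = quot_class y <-> Id S (x - y).
Proof.
split=> [/eqP|h]; [|apply/eqP];
  rewrite /quot_class -[_ == _]Quotient.idealrBE.
  by move/asboolP.
exact/asboolP.
Qed.

Lemma quot_classK (x : quotAlg) : quot_class (repr x) = x.
Proof. exact: reprK. Qed.

Lemma quot_classD : {morph quot_class : x y / x + y}.
Proof. by move=> x y; rewrite /quot_class [LHS]Quotient.pi_add. Qed.

Lemma Id_repr x : Id S (repr (quot_class x) - x).
Proof. by apply/quot_classP; rewrite quot_classK. Qed.

Definition quot_scale (c : k) (x : quotAlg) := quot_class (c *: repr x).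
Definition quot_prec (x y : quotAlg) := quot_class (repr x \prec repr y).
Definition quot_succ (x y : quotAlg) := quot_class (repr x \succ repr y).

Lemma IdD x y : Id S x -> Id S y -> Id S (x + y).
Proof. by case: (Id_ideal S) => _ h _ _ Sx Sy; rewrite -[x]scale1r; exact: h. Qed.

Lemma quot_classZ c x : quot_class (c *: x) = quot_scale c (quot_class x).
Proof.
apply/esym/quot_classP; rewrite -scalerBr -[_ *: _]addr0.
by case: (Id_ideal S) => h0 h _ _; apply: h => //; exact: Id_repr.
Qed.

Lemma quot_class_prec x y :
  quot_class (x \prec y) = quot_prec (quot_class x) (quot_class y).
Proof.
apply/esym/quot_classP.
set x' := repr _; set y' := repr _.
have -> : x' \prec y' - x \prec y = (x' - x) \prec y' + x \prec (y' - y).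
  have -> : x' - x = (-1) *: x + x' by rewrite scaleN1r addrC.
  have -> : y' - y = (-1) *: y + y' by rewrite scaleN1r addrC.
  rewrite aprec_linearl aprec_linearr !scaleN1r.
  by rewrite [- (x \prec y') + _]addrC [- (x \prec y) + _]addrC addrA subrK.
case: (Id_ideal S) => _ _ h _; apply: IdD.
  by case: (h _ y' (Id_repr x)).
by case: (h _ x (Id_repr y)).
Qed.

Lemma quot_class_succ x y :
  quot_class (x \succ y) = quot_succ (quot_class x) (quot_class y).
Proof.
apply/esym/quot_classP.
set x' := repr _; set y' := repr _.
have -> : x' \succ y' - x \succ y = (x' - x) \succ y' + x \succ (y' - y).
  have -> : x' - x = (-1) *: x + x' by rewrite scaleN1r addrC.
  have -> : y' - y = (-1) *: y + y' by rewrite scaleN1r addrC.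
  rewrite asucc_linearl asucc_linearr !scaleN1r.
  by rewrite [- (x \succ y') + _]addrC [- (x \succ y) + _]addrC addrA subrK.
case: (Id_ideal S) => _ _ _ h; apply: IdD.
  by case: (h _ y' (Id_repr x)).
by case: (h _ x (Id_repr y)).
Qed.

Fact quot_scaleA c1 c2 x : quot_scale c1 (quot_scale c2 x) = quot_scale (c1 * c2) x.
Proof. by rewrite -[x]quot_classK -!quot_classZ scalerA. Qed.
Fact quot_scale1 : left_id 1 quot_scale.
Proof. by move=> x; rewrite -[x]quot_classK -!quot_classZ scale1r. Qed.
Fact quot_scaleDr : right_distributive quot_scale +%R.
Proof.
move=> c x y; rewrite -[x]quot_classK -[y]quot_classK.
by rewrite -!(quot_classZ, quot_classD) scalerDr.
Qed.
Fact quot_scaleDl x : {morph quot_scale^~ x : c1 c2 / c1 + c2}.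
Proof.
move=> c1 c2; rewrite -[x]quot_classK /=.
by rewrite -!(quot_classZ, quot_classD) scalerDl.
Qed.

HB.instance Definition _ := GRing.Zmodule_isLmodule.Build k quotAlg
  quot_scaleA quot_scale1 quot_scaleDr quot_scaleDl.

Lemma quot_class_linear : linear quot_class.
Proof. by move=> c x y; rewrite quot_classD quot_classZ. Qed.

Fact quot_prec_linearl y : linear (quot_prec ^~ y).
Proof.
move=> c x1 x2; rewrite -[x1]quot_classK -[x2]quot_classK -[y]quot_classK.
by rewrite -quot_class_linear -!quot_class_prec aprec_linearl quot_class_linear.
Qed.
Fact quot_prec_linearr x : linear (quot_prec x).
Proof.
move=> c y1 y2; rewrite -[y1]quot_classK -[y2]quot_classK -[x]quot_classK.
by rewrite -quot_class_linear -!quot_class_prec aprec_linearr quot_class_linear.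
Qed.
Fact quot_succ_linearl y : linear (quot_succ ^~ y).
Proof.
move=> c x1 x2; rewrite -[x1]quot_classK -[x2]quot_classK -[y]quot_classK.
by rewrite -quot_class_linear -!quot_class_succ asucc_linearl quot_class_linear.
Qed.
Fact quot_succ_linearr x : linear (quot_succ x).
Proof.
move=> c y1 y2; rewrite -[y1]quot_classK -[y2]quot_classK -[x]quot_classK.
by rewrite -quot_class_linear -!quot_class_succ asucc_linearr quot_class_linear.
Qed.

HB.instance Definition _ := Lmodule_isOmegaAlg.Build k quotAlg
  quot_prec_linearl quot_prec_linearr quot_succ_linearl quot_succ_linearr.

End QuotientAlgebra.

Section WordAlgebra.
Variables (k : fieldType) (X : choiceType).
Local Notation kX := {malg k[word X]}.

Section BilinearExtension.
Variable op : word X -> word X -> word X.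

Definition extend_op (f g : kX) : kX :=
  \sum_(u <- msupp f) \sum_(v <- msupp g) << f@_u * g@_v *g op u v >>.

Lemma extend_opEw (d1 d2 : {fset word X}) (f g : kX) :
  (msupp f `<=` d1)%fset -> (msupp g `<=` d2)%fset ->
  extend_op f g = \sum_(u <- d1) \sum_(v <- d2) << f@_u * g@_v *g op u v >>.
Proof.
move=> le_d1 le_d2; rewrite /extend_op (big_fset_incl _ le_d1) /=.
  apply/eq_bigr=> u _; apply/big_fset_incl => // v _ /mcoeff_outdom ->.
  by rewrite mulr0 monalgU0.
move=> u _ /mcoeff_outdom fu.
by rewrite big1 => // v _; rewrite fu mul0r monalgU0.
Qed.

Lemma extend_opU (u v : word X) : extend_op << u >> << v >> = << op u v >>.
Proof. by rewrite (extend_opEw msuppU_le msuppU_le) !big_seq_fset1 !mcoeffUU mulr1. Qed.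

Lemma scale_malgU (c a : k) (u : word X) : c *: << a *g u >> = << c * a *g u >> :> kX.
Proof. by apply/malgP=> w; rewrite mcoeffZ !mcoeffU mulrnAr. Qed.

Lemma extend_op_linearl (g : kX) : linear (extend_op ^~ g).
Proof.
move=> c f1 f2; pose d := (msupp (c *: f1 + f2) `|` msupp f1 `|` msupp f2)%fset.
have s0 : (msupp (c *: f1 + f2) `<=` d)%fset by rewrite /d -fsetUA fsubsetUl.
have s1 : (msupp f1 `<=` d)%fset by rewrite /d fsetUAC fsubsetUr.
have s2 : (msupp f2 `<=` d)%fset by rewrite fsubsetUr.
have sg := fsubset_refl (msupp g).
rewrite (extend_opEw s0 sg) (extend_opEw s1 sg) (extend_opEw s2 sg).
rewrite scaler_sumr -big_split; apply: eq_bigr => u _ /=.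
rewrite scaler_sumr -big_split; apply: eq_bigr => v _ /=.
by rewrite scale_malgU -monalgUD mcoeffD mcoeffZ mulrDl mulrA.
Qed.

Lemma extend_op_linearr (f : kX) : linear (extend_op f).
Proof.
move=> c g1 g2; pose d := (msupp (c *: g1 + g2) `|` msupp g1 `|` msupp g2)%fset.
have s0 : (msupp (c *: g1 + g2) `<=` d)%fset by rewrite /d -fsetUA fsubsetUl.
have s1 : (msupp g1 `<=` d)%fset by rewrite /d fsetUAC fsubsetUr.
have s2 : (msupp g2 `<=` d)%fset by rewrite fsubsetUr.
have sf := fsubset_refl (msupp f).
rewrite (extend_opEw sf s0) (extend_opEw sf s1) (extend_opEw sf s2).
rewrite scaler_sumr -big_split; apply: eq_bigr => u _ /=.
rewrite scaler_sumr -big_split; apply: eq_bigr => v _ /=.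
by rewrite scale_malgU -monalgUD mcoeffD mcoeffZ mulrDr mulrCA.
Qed.

End BilinearExtension.

Definition wordAlg : Type := kX.

HB.instance Definition _ := GRing.Lmodule.on wordAlg.
HB.instance Definition _ := Lmodule_isOmegaAlg.Build k wordAlg
  (extend_op_linearl (@Prec X)) (extend_op_linearr (@Prec X))
  (extend_op_linearl (@Succ X)) (extend_op_linearr (@Succ X)).

Definition basis_word (u : word X) : wordAlg := << u >>.

Lemma basis_word_prec u v : basis_word (u \prec v) = basis_word u \prec basis_word v.
Proof. exact/esym/extend_opU. Qed.

Lemma basis_word_succ u v : basis_word (u \succ v) = basis_word u \succ basis_word v.
Proof. exact/esym/extend_opU. Qed.

(* The generators of the ideal: the identity is imposed on words only. *)
Definition L_relations : set wordAlg :=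
  [set f | exists x y z : word X,
     f = basis_word ((x \succ y) \prec z) - basis_word (x \succ (y \prec z))].

(* k(X, Omega | S), the quotient of the free Omega-algebra by Id(S) *)
Definition LX : omegaAlgType k := quotAlg L_relations.

Definition word_class (u : word X) : LX := quot_class L_relations (basis_word u).

End WordAlgebra.

Arguments word_class k {X} u.

(* Main.v *)
Require Import Defs.
From HB Require Import structures.
From mathcomp Require Import all_boot all_order all_algebra.
From mathcomp Require Import finmap monalg.
From mathcomp Require Import boolp classical_sets wochoice.

(** The relation rewrites [(x \succ y) \prec z] into [x \succ (y \prec z)], and
on normal forms this rewriting is a recursive operation: to multiply normal
words [v] and [w] by [\prec], walk down the right spine of [\succ]'s of [v] and
graft [w] at its end ([rot_prec]).  The decisive remark is that the free module
on words, with [\prec] replaced by the bilinear extension of [rot_prec], is an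
L-algebra by the very recursion that defines [rot_prec] ([rot_Lalgebra]).

The quotient [LX k X] is the free L-algebra because evaluating words in an
L-algebra kills the relations, hence the ideal they generate, and because words
span.  Its universal property applied to the rotated algebra yields a linear map
[lx_nf] from [LX k X] to the module on words, which sends the class of a word to
its normal form [nf u].  This replaces any confluence argument:
- normal words are their own normal forms, so [lx_nf] maps the classes of normal
  words to distinct basis vectors, and these classes are independent;
- a word and its normal form have the same class, so taking the class is a left
  inverse of [lx_nf]; as [lx_nf] takes its values in the span of the normal
  words, their classes span [LX k X].

Finally a word is irreducible exactly when it is normal: both conditions pass
to subwords, and at the root both exclude the shape [(a \succ b) \prec c]. *)

Set Implicit Arguments.
Unset Strict Implicit.
Unset Printing Implicit Defensive.

Import GRing.Theory.

Local Open Scope classical_set_scope.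
Local Open Scope ring_scope.

(** * Normal words and irreducible words *)

Section NormalWords.
Variable X : Type.
Local Open Scope word_scope.
Implicit Types (u v w s a b c : word X) (t : word (option X)).

Lemma normal_word_prec v w : normal_word (v \prec w) ->
  [/\ normal_word v, normal_word w & forall v1 v2, v <> v1 \succ v2].
Proof. by move=> h; inversion h. Qed.

Lemma normal_word_succ v w :
  normal_word (v \succ w) -> normal_word v /\ normal_word w.
Proof. by move=> h; inversion h. Qed.

Lemma normal_word_subst_star t s :
  (0 < star_count t)%N -> normal_word (subst_star t s) -> normal_word s.
Proof.
elim: t => [[x|]|t1 IH1 t2 IH2|t1 IH1 t2 IH2] //=; rewrite addn_gt0.
- by move=> /orP[/IH1 h|/IH2 h] /normal_word_prec[] *; apply: h.
- by move=> /orP[/IH1 h|/IH2 h] /normal_word_succ[] *; apply: h.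
Qed.

(** A context for a subword becomes one for the whole word once the remaining
letters are read as letters other than the star. *)
Fixpoint starless u : word (option X) :=
  match u with
  | Var x => Var (Some x)
  | v \prec w => starless v \prec starless w
  | v \succ w => starless v \succ starless w
  end.

Lemma star_count_starless u : star_count (starless u) = 0%N.
Proof. by elim: u => //= v -> w ->. Qed.

Lemma subst_star_starless u s : subst_star (starless u) s = u.
Proof. by elim: u => //= v -> w ->. Qed.

Lemma Irr_prec v w : Irr X (v \prec w) -> Irr X v /\ Irr X w.
Proof.
move=> h; split=> a b c t t1 def.
- apply: (h a b c (t \prec starless w)); last by rewrite /= -def subst_star_starless.
  by rewrite /star_word /= star_count_starless addn0.
- apply: (h a b c (starless v \prec t)); last by rewrite /= -def subst_star_starless.
  by rewrite /star_word /= star_count_starless.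
Qed.

Lemma Irr_succ v w : Irr X (v \succ w) -> Irr X v /\ Irr X w.
Proof.
move=> h; split=> a b c t t1 def.
- apply: (h a b c (t \succ starless w)); last by rewrite /= -def subst_star_starless.
  by rewrite /star_word /= star_count_starless addn0.
- apply: (h a b c (starless v \succ t)); last by rewrite /= -def subst_star_starless.
  by rewrite /star_word /= star_count_starless.
Qed.

Lemma Irr_normal : Irr X = [set u | normal_word u].
Proof.
apply/seteqP; split=> [u|u nu a b c t t1 def] /=.
- elim: u => [x|v IHv w IHw|v IHv w IHw] irr; first exact: normal_var.
  + have [/IHv nv /IHw nw] := Irr_prec irr; apply: normal_prec => // v1 v2 def.
    (* the star alone is the context of a redex sitting at the root *)
    by apply: (irr v1 v2 w (Var None)); rewrite //= def.
  + by have [/IHv nv /IHw nw] := Irr_succ irr; apply: normal_succ.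
- have /normal_word_prec[_ _ /(_ a b)//] : normal_word ((a \succ b) \prec c).
  by apply: (@normal_word_subst_star t); [rewrite t1 | rewrite -def].
Qed.

Fixpoint rot_prec v w : word X :=
  if v is v1 \succ v2 then v1 \succ rot_prec v2 w else v \prec w.

Fixpoint nf u : word X :=
  match u with
  | Var x => Var x
  | v \prec w => rot_prec (nf v) (nf w)
  | v \succ w => nf v \succ nf w
  end.

Lemma normal_rot_prec v w :
  normal_word v -> normal_word w -> normal_word (rot_prec v w).
Proof.
elim: v => [x|v1 _ v2 _|v1 _ v2 IH] nv nw /=; try exact: normal_prec.
by have [nv1 nv2] := normal_word_succ nv; apply: normal_succ => //; apply: IH.
Qed.

Lemma normal_nf u : normal_word (nf u).
Proof.
elim: u => [x|v nv w nw|v nv w nw] /=; first exact: normal_var.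
- exact: normal_rot_prec.
- exact: normal_succ.
Qed.

Lemma nf_normal u : normal_word u -> nf u = u.
Proof.
elim=> [//|v w _ /= -> _ -> //|v w _ /= -> _ -> not_succ].
by case: v not_succ => //= v1 v2 /(_ v1 v2).
Qed.

End NormalWords.

(** * Linear maps on the free algebra of words *)

Section LinearMaps.
Variables (k : fieldType) (U V : lmodType k) (f : U -> V).
Hypothesis f_lin : linear f.

Lemma linear_map0 : f 0 = 0.
Proof. by have := f_lin (-1) 0 0; rewrite !scaleN1r oppr0 addr0 addNr. Qed.

Lemma linear_mapB x y : f (x - y) = f x - f y.
Proof. by rewrite addrC -scaleN1r f_lin scaleN1r addrC. Qed.

Lemma linear_map_sum (I : Type) (s : seq I) (c : I -> k) (e : I -> U) :
  f (\sum_(i <- s) c i *: e i) = \sum_(i <- s) c i *: f (e i).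
Proof.
elim: s => [|i s IH]; first by rewrite !big_nil linear_map0.
by rewrite !big_cons f_lin IH.
Qed.

End LinearMaps.

Section WordModule.
Variables (k : fieldType) (X : choiceType).
Local Notation kX := (wordAlg k X).
Local Notation "[ u ]" := (basis_word k u) (format "[ u ]").
Implicit Types u v w : word X.

Lemma wordAlgE (p : kX) : p = \sum_(u <- msupp p) p@_u *: [u].
Proof.
rewrite [LHS]monalgE; apply: eq_bigr => u _.
by rewrite [RHS]scale_malgU mulr1.
Qed.

Lemma mcoeff_scale_word c u v : (c *: [u])@_v = c * (u == v)%:R.
Proof. by rewrite [LHS]mcoeffZ mcoeffU. Qed.

Lemma mcoeff_word_sum (s : seq (word X)) (c : word X -> k) u :
  uniq s -> u \in s -> (\sum_(v <- s) c v *: [v])@_u = c u.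
Proof.
move=> s_uniq su.
have -> : (\sum_(v <- s) c v *: [v])@_u = \sum_(v <- s) c v * (v == u)%:R.
  rewrite [LHS]raddf_sum; apply: eq_bigr => v _; exact: mcoeff_scale_word.
rewrite (bigD1_seq u) //= eqxx mulr1 big1 ?addr0 // => v /negbTE ->.
exact: mulr0.
Qed.

Lemma wordAlg_ind (P : kX -> Prop) :
  P 0 -> (forall c u p, P p -> P (c *: [u] + p)) -> forall p, P p.
Proof.
move=> P0 PD p; rewrite [p]wordAlgE.
elim: (X in \sum_(u <- X) _) => [|u s IH]; first by rewrite big_nil.
by rewrite big_cons; apply: PD.
Qed.

Lemma wordAlg_linear_ext (V : lmodType k) (f g : kX -> V) :
  linear f -> linear g -> (forall u, f [u] = g [u]) -> f =1 g.
Proof.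
move=> f_lin g_lin fg; elim/wordAlg_ind => [|c u p IH].
  by rewrite !linear_map0.
by rewrite f_lin g_lin fg IH.
Qed.

Section LinearExtension.
Variables (V : lmodType k) (g : word X -> V).

Definition lin_ext (p : kX) : V := \sum_(u <- msupp p) p@_u *: g u.

Lemma lin_extEw (D : {fset word X}) (p : kX) :
  (msupp p `<=` D)%fset -> lin_ext p = \sum_(u <- D) p@_u *: g u.
Proof.
move=> sD; apply: big_fset_incl => // u _ /mcoeff_outdom ->.
by rewrite scale0r.
Qed.

Lemma lin_ext_linear : linear lin_ext.
Proof.
move=> c p q; pose D := (msupp (c *: p + q) `|` msupp p `|` msupp q)%fset.
have s0 : (msupp (c *: p + q) `<=` D)%fset by rewrite /D -fsetUA fsubsetUl.
have s1 : (msupp p `<=` D)%fset by rewrite /D fsetUAC fsubsetUr.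
have s2 : (msupp q `<=` D)%fset by rewrite fsubsetUr.
rewrite (lin_extEw s0) (lin_extEw s1) (lin_extEw s2) scaler_sumr -big_split.
by apply: eq_bigr => u _ /=; rewrite mcoeffD mcoeffZ scalerDl scalerA.
Qed.

Lemma lin_ext_word u : lin_ext [u] = g u.
Proof. by rewrite (lin_extEw msuppU_le) big_seq_fset1 mcoeffUU scale1r. Qed.

End LinearExtension.

Lemma wordAlg_bilinear_ext (V : lmodType k) (F G : kX -> kX -> V) :
    (forall q, linear (F ^~ q)) -> (forall p, linear (F p)) ->
    (forall q, linear (G ^~ q)) -> (forall p, linear (G p)) ->
    (forall u v, F [u] [v] = G [u] [v]) ->
  forall p q, F p q = G p q.
Proof.
move=> Fl Fr Gl Gr FG p q.
apply: (wordAlg_linear_ext (f := F ^~ q) (g := G ^~ q)) => // u.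
exact: (wordAlg_linear_ext (f := F [u]) (g := G [u])).
Qed.

(** Bilinearity of both sides reduces multiplicativity to pairs of words. *)
Lemma wordAlg_morph (A : omegaAlgType k) (f : kX -> A) : linear f ->
    (forall u v, f [(u \prec v)%W] = f [u] \prec f [v]) ->
    (forall u v, f [(u \succ v)%W] = f [u] \succ f [v]) ->
  omega_morphism f.
Proof.
move=> f_lin f_prec f_succ; split=> //; apply: wordAlg_bilinear_ext.
- by move=> q c p p'; rewrite aprec_linearl f_lin.
- by move=> p c q q'; rewrite aprec_linearr f_lin.
- by move=> q c p p'; rewrite f_lin aprec_linearl.
- by move=> p c q q'; rewrite f_lin aprec_linearr.
- by move=> u v; rewrite -basis_word_prec f_prec.
- by move=> q c p p'; rewrite asucc_linearl f_lin.
- by move=> p c q q'; rewrite asucc_linearr f_lin.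
- by move=> q c p p'; rewrite f_lin asucc_linearl.
- by move=> p c q q'; rewrite f_lin asucc_linearr.
- by move=> u v; rewrite -basis_word_succ f_succ.
Qed.

(** The defining identity is trilinear, so it may be tested on a family that
spans; words span both algebras to which this is applied below. *)
Lemma Lalgebra_spanned (A : omegaAlgType k) (e : kX -> A) : linear e ->
    (forall a, exists p, e p = a) ->
    (forall u v w, (e [u] \succ e [v]) \prec e [w]
       = e [u] \succ (e [v] \prec e [w])) ->
  is_Lalgebra A.
Proof.
move=> e_lin e_surj eL x y z.
have [[p <-] [q <-] [r <-]] := And3 (e_surj x) (e_surj y) (e_surj z).
have e0 := linear_map0 e_lin.
have l0 a := linear_map0 (aprec_linearl a).
have r0 a := linear_map0 (aprec_linearr a).
have sl0 a := linear_map0 (asucc_linearl a).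
have sr0 a := linear_map0 (asucc_linearr a).
elim/wordAlg_ind: p => [|c u p IHp]; first by rewrite e0 sl0 l0 sl0.
rewrite e_lin !asucc_linearl aprec_linearl IHp; congr (_ *: _ + _).
elim/wordAlg_ind: q {p IHp} => [|d v q IHq]; first by rewrite e0 sr0 l0 sr0.
rewrite e_lin !(asucc_linearr, aprec_linearl) IHq; congr (_ *: _ + _).
elim/wordAlg_ind: r {q IHq} => [|b w r IHr]; first by rewrite e0 !r0 sr0.
by rewrite e_lin !(asucc_linearr, aprec_linearr) IHr eL.
Qed.

(** * The quotient is the free L-algebra *)

Local Notation LX := (LX k X).
Local Notation class := (quot_class (@L_relations k X)).

Lemma word_class_prec u v :
  word_class k (u \prec v)%W = word_class k u \prec word_class k v.
Proof. by rewrite /word_class basis_word_prec quot_class_prec. Qed.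

Lemma word_class_succ u v :
  word_class k (u \succ v)%W = word_class k u \succ word_class k v.
Proof. by rewrite /word_class basis_word_succ quot_class_succ. Qed.

Lemma word_class_L u v w :
  word_class k ((u \succ v) \prec w)%W = word_class k (u \succ (v \prec w))%W.
Proof. by apply/quot_classP => I [_]; apply; exists u, v, w. Qed.

Lemma class_linear : linear (class : kX -> LX).
Proof. exact: quot_class_linear. Qed.

Lemma LX_Lalgebra : is_Lalgebra LX.
Proof.
apply: (Lalgebra_spanned class_linear) => [a|u v w].
  by exists (repr a); apply: quot_classK.
rewrite -!/(word_class k _).
by rewrite -!(word_class_prec, word_class_succ) word_class_L.
Qed.

Lemma omega_morphism_ker_ideal (A B : omegaAlgType k) (f : A -> B) :
  omega_morphism f -> is_ideal [set x | f x = 0].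
Proof.
case=> f_lin f_prec f_succ; split=> /= [|c x y fx fy|x y fx|x y fx].
- exact: linear_map0.
- by rewrite f_lin fx fy scaler0 addr0.
- rewrite !f_prec fx (linear_map0 (aprec_linearl _)).
  by rewrite (linear_map0 (aprec_linearr _)).
- rewrite !f_succ fx (linear_map0 (asucc_linearl _)).
  by rewrite (linear_map0 (asucc_linearr _)).
Qed.

Section Universal.
Variables (A : omegaAlgType k) (f : X -> A).

Fixpoint eval_word (u : word X) : A :=
  match u with
  | Var x => f x
  | Prec v w => eval_word v \prec eval_word w
  | Succ v w => eval_word v \succ eval_word w
  end.

Definition eval_LX (x : LX) : A := lin_ext eval_word (repr x).

Hypothesis A_L : is_Lalgebra A.

Lemma lin_ext_eval_morph : omega_morphism (lin_ext eval_word).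
Proof.
by apply: wordAlg_morph => [|u v|u v]; rewrite ?lin_ext_word //;
  apply: lin_ext_linear.
Qed.

Lemma eval_LX_class p : eval_LX (class p) = lin_ext eval_word p.
Proof.
apply/eqP; rewrite /eval_LX -subr_eq0 -linear_mapB; last exact: lin_ext_linear.
apply/eqP; apply: (@Id_repr _ _ _ p [set q | lin_ext eval_word q = 0]); split.
  exact: omega_morphism_ker_ideal lin_ext_eval_morph.
move=> _ [u [v [w ->]]] /=; rewrite linear_mapB; last exact: lin_ext_linear.
by rewrite !lin_ext_word /= A_L subrr.
Qed.

Lemma eval_LX_word u : eval_LX (word_class k u) = eval_word u.
Proof. by rewrite eval_LX_class lin_ext_word. Qed.

Lemma eval_LX_morph : omega_morphism eval_LX.
Proof.
have [e_lin e_prec e_succ] := lin_ext_eval_morph.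
split=> [c x y|x y|x y]; rewrite -[x]quot_classK -[y]quot_classK.
- by rewrite -class_linear !eval_LX_class e_lin.
- by rewrite -[_ \prec _]quot_class_prec !eval_LX_class e_prec.
- by rewrite -[_ \succ _]quot_class_succ !eval_LX_class e_succ.
Qed.

Lemma eval_LX_unique (phi : LX -> A) : omega_morphism phi ->
  (forall x, phi (word_class k (Var x)) = f x) -> eval_LX = phi.
Proof.
case=> phi_lin phi_prec phi_succ phiX; have [e_lin _ _] := eval_LX_morph.
apply/funext => x; rewrite -[x]quot_classK.
apply: (wordAlg_linear_ext (f := eval_LX \o class) (g := phi \o class)).
- by move=> c p q /=; rewrite class_linear e_lin.
- by move=> c p q /=; rewrite class_linear phi_lin.
move=> u /=; rewrite -/(word_class k u) eval_LX_word.
elim: u => [a|v IHv w IHw|v IHv w IHw] /=; first by rewrite phiX.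
- by rewrite word_class_prec phi_prec -IHv -IHw.
- by rewrite word_class_succ phi_succ -IHv -IHw.
Qed.

End Universal.

Lemma LX_free : is_free_Lalgebra (L := LX) (fun x : X => word_class k (Var x)).
Proof.
split=> [|A A_L f]; first exact: LX_Lalgebra.
exists (eval_LX f); split=> [|phi [phi_morph phiX]].
  by split=> [|x]; [exact: eval_LX_morph | rewrite eval_LX_word].
exact: eval_LX_unique.
Qed.

(** * Normal forms of classes and the basis *)

(** A separate name for the carrier, so that it bears the rotated product
instead of the free one. *)
Definition rotAlg : Type := kX.

HB.instance Definition _ := GRing.Lmodule.on rotAlg.
HB.instance Definition _ := Lmodule_isOmegaAlg.Build k rotAlg
  (extend_op_linearl (@rot_prec X)) (extend_op_linearr (@rot_prec X))
  (extend_op_linearl (@Succ X)) (extend_op_linearr (@Succ X)).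

Lemma rot_precE u v : ([u] : rotAlg) \prec [v] = [rot_prec u v].
Proof. exact: extend_opU. Qed.

Lemma rot_succE u v : ([u] : rotAlg) \succ [v] = [(u \succ v)%W].
Proof. exact: extend_opU. Qed.

(** On words the identity is the recursive clause of [rot_prec]; unlike the
free product, it needs no quotient. *)
Lemma rot_Lalgebra : is_Lalgebra rotAlg.
Proof.
apply: (Lalgebra_spanned (e := id : kX -> rotAlg)) => // [a|u v w].
  by exists a.
by rewrite !(rot_precE, rot_succE).
Qed.

Definition lx_nf : LX -> kX := @eval_LX rotAlg (fun x => [Var x]).

Lemma lx_nf_linear : linear lx_nf.
Proof.
have [nf_lin _ _] := @eval_LX_morph rotAlg (fun x => [Var x]) rot_Lalgebra.
exact: nf_lin.
Qed.

Lemma lx_nf_word u : lx_nf (word_class k u) = [nf u].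
Proof.
rewrite /lx_nf eval_LX_word; last exact: rot_Lalgebra.
elim: u => [x|v IHv w IHw|v IHv w IHw] //=; rewrite IHv IHw.
- exact: rot_precE.
- exact: rot_succE.
Qed.

Lemma word_class_rot_prec u v :
  word_class k (rot_prec u v) = word_class k (u \prec v)%W.
Proof.
elim: u => [x|u1 _ u2 _|u1 _ u2 IH]; [by [] | by [] |].
rewrite [rot_prec _ _]/=.
by rewrite word_class_succ IH -word_class_succ word_class_L.
Qed.

Lemma word_class_nf u : word_class k (nf u) = word_class k u.
Proof.
elim: u => [//|v IHv w IHw|v IHv w IHw] /=.
- by rewrite word_class_rot_prec !word_class_prec IHv IHw.
- by rewrite !word_class_succ IHv IHw.
Qed.

Lemma class_lx_nf : cancel lx_nf class.
Proof.
move=> x; rewrite -{2}[x]quot_classK -[x in lx_nf x]quot_classK.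
apply: (wordAlg_linear_ext (f := class \o lx_nf \o class) (g := class)).
- by move=> c p q /=; rewrite class_linear lx_nf_linear class_linear.
- exact: class_linear.
- by move=> u /=; rewrite -!/(word_class k _) lx_nf_word -word_class_nf.
Qed.

Lemma normal_msupp_lx_nf x u : u \in msupp (lx_nf x) -> normal_word u.
Proof.
rewrite -[x]quot_classK; elim/wordAlg_ind: (repr x) => [|c v p IH].
  by rewrite (linear_map0 class_linear) (linear_map0 lx_nf_linear) msupp0 inE.
rewrite class_linear lx_nf_linear => /(fsubsetP (msuppD_le _ _)).
rewrite in_fsetU => /orP[|/IH//]; rewrite -/(word_class k v) lx_nf_word.
move=> /(fsubsetP (msuppZ_le _ _)) /(fsubsetP msuppU_le).
by rewrite in_fset1 => /eqP ->; apply: normal_nf.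
Qed.

Lemma normal_word_basis :
  is_basis (V := LX) [set u | normal_word u] (word_class k).
Proof.
split=> [s c s_uniq s_normal dep u su | x].
- have : \sum_(v <- s) c v *: [v] = 0.
    have := linear_map_sum lx_nf_linear s c (word_class k).
    rewrite dep (linear_map0 lx_nf_linear) => nf_dep; rewrite [RHS]nf_dep.
    by apply: eq_big_seq => v sv; rewrite lx_nf_word nf_normal //; apply: s_normal.
  by move=> /(congr1 (mcoeff u)); rewrite mcoeff0 mcoeff_word_sum.
- exists (msupp (lx_nf x)), (fun u => (lx_nf x)@_u); split.
    exact: normal_msupp_lx_nf.
  have := linear_map_sum class_linear (msupp (lx_nf x))
    (fun u => (lx_nf x)@_u) (@basis_word k X).
  by rewrite -wordAlgE class_lx_nf.
Qed.

End WordModule.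

Theorem corollary3p3 (k : fieldType) (d : Order.disp_t) (X : orderType d)
    (X_wo : well_order (<=%O : rel X)) :
  [/\ is_free_Lalgebra (L := LX k X) (fun x : X => word_class k (Var x)),
      is_basis (V := LX k X) (Irr X) (word_class k)
    & Irr X = [set u | normal_word u]].
Proof.
by split; [exact: LX_free | rewrite Irr_normal; exact: normal_word_basis
         | exact: Irr_normal].
Qed.
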